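(* Let $G$ be a finitely generated torsion-free CSA group. Let $\mathcal{E}$ be the class of non-trivial abelian subgroups of $G$ and let $\sim$ be commutation. Let $T$ be an $\mathcal{E}$-tree, with tree of cylinders $T_c$ and collapsed tree of cylinders $T_c^*$. Then: 1. Edge stabilizers of $T_c$ are non-trivial and abelian, so $T_c^*=T_c$. 2. $T$ and $T_c$ have the same non-abelian vertex stabilizers. A subgroup is elliptic in $T_c$ if and only if it is elliptic in $T$ or is a non-cyclic abelian group. In particular, $T_c$ is in the same deformation space as $T$ if and only if every non-cyclic abelian subgroup of $G$ is elliptic in $T$. 3. $T_c$ is $2$-acylindrical and dominates any acylindrical $\mathcal{E}$-tree $T'$ which is dominated by $T$.
   Context: $G$ is CSA if centralizers of non-trivial elements are abelian and maximal abelian subgroups are malnormal ($A$ is malnormal if $g^{-1}Ag\cap A\neq\{1\}$ implies $g\in A$). For non-trivial abelian subgroups $A,B$, $A\sim B$ (commutation) iff $\langle A,B\rangle$ is abelian. A tree is a simplicial tree with an action of $G$ without inversions; $G_e$ is the stabilizer of an edge $e$. An $\mathcal{E}$-tree is a tree all of whose edge stabilizers belong to $\mathcal{E}$. A subgroup is elliptic in a tree if it fixes a point. $T$ dominates $T'$ if there is a $G$-equivariant map $T\to T'$, equivalently if every subgroup elliptic in $T$ is elliptic in $T'$. Two trees are in the same deformation space if they have the same elliptic subgroups. A tree is $k$-acylindrical if the (pointwise) stabilizer of any segment of length $>k$ is trivial, and acylindrical if this holds for some $k$. Tree of cylinders. Declare two edges $e,e'$ of $T$ equivalent if $G_e\sim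 G_{e'}$. A cylinder of $T$ is an equivalence class $Y$ of edges, identified with the union of its edges; cylinders are subtrees of $T$ and two distinct cylinders meet in at most one point. $T_c$ is the bipartite tree with vertex set $V_0(T_c)\sqcup V_1(T_c)$, where $V_0(T_c)$ is the set of vertices of $T$ belonging to at least two distinct cylinders, $V_1(T_c)$ is the set of cylinders of $T$, and there is an edge $(x,Y)$ between $x\in V_0(T_c)$ and $Y\in V_1(T_c)$ if and only if $x\in Y$. It carries the induced $G$-action. If $T$ is a single point, $T_c$ is understood to be a point. $T_c^*$ is obtained from $T_c$ by collapsing all edges whose stabilizer is not in $\mathcal{E}$.
   Formalization: In item 2, ''or is a non-cyclic abelian group'' is replaced by ''or is contained in a non-cyclic abelian subgroup'', since as written it fails for cyclic subgroups: in ⟨a,b,h | [a,h]=1⟩ with the HNN tree over ⟨a⟩, ⟨h⟩ is elliptic in T_c, not in T. *)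

(* Defs.v *)
From mathcomp Require Import all_boot.
From mathcomp Require Import boolp classical_sets.

Set Implicit Arguments.
Unset Strict Implicit.
Unset Printing Implicit Defensive.

Local Open Scope classical_set_scope.
Local Open Scope group_scope.

Section Groups.
Variable G : groupType.
Implicit Types (A B H : set G).

Definition subgroup A := A 1 /\ forall x y, A x -> A y -> A (x / y).

Definition generated A : set G := smallest subgroup A.

Definition abelian A := forall x y, A x -> A y -> commute x y.

Definition cyclic A := exists x, A = generated [set x].

Definition finitely_generated := exists s : seq G, generated [set` s] = setT.

Definition torsion_free := forall (x : G) n, (0 < n)%N -> x ^+ n = 1 -> x = 1.

Definition centralizer (x : G) : set G := [set y | commute x y].

Definition maximal_abelian A :=
  [/\ subgroup A, abelian A &
      forall B, subgroup B -> abelian B -> A `<=` B -> B = A].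

(* [x ^ g] is the conjugate [g^-1 * x * g]. *)
Definition malnormal A :=
  forall g : G, [set x ^ g | x in A] `&` A <> [set 1] -> A g.

Definition CSA :=
  (forall x : G, x <> 1 -> abelian (centralizer x)) /\
  (forall A, maximal_abelian A -> malnormal A).

Definition nontrivial_abelian : set (set G) :=
  [set A | [/\ subgroup A, abelian A & A <> [set 1]]].

Definition commutation A B := abelian (generated (A `|` B)).

End Groups.

Arguments finitely_generated : clear implicits.
Arguments torsion_free : clear implicits.
Arguments CSA : clear implicits.
Arguments nontrivial_abelian : clear implicits.

(* A simplicial tree is handled through its 1-skeleton: a graph on the set of
   vertices, with a left action of [G] by graph automorphisms. *)
Record ggraph (G : groupType) := GGraph {
  vertex :> choiceType;
  adj : rel vertex;
  act : G -> vertex -> vertex;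
  act1 : forall x, act 1 x = x;
  actM : forall g h x, act (g * h) x = act g (act h x);
  adj_act : forall g x y, adj (act g x) (act g y) = adj x y
}.

Section GGraphs.
Variable G : groupType.
Implicit Types (T : ggraph G) (H : set G).

Record is_tree T : Prop := IsTree {
  tree_nonempty : exists x : T, True;
  tree_irrefl : irreflexive (@adj G T);
  tree_sym : symmetric (@adj G T);
  tree_connected :
    forall x y : T, exists2 p, path (@adj G T) x p & last x p = y;
  tree_acyclic :
    forall c : seq T, ucycle (@adj G T) c -> (size c <= 2)%N;
  tree_no_inversion :
    forall g (x y : T), adj x y -> ~ (act g x = y /\ act g y = x)
}.

Definition vstab T (x : T) : set G := [set g | act g x = x].

(* Without inversions, the pointwise and the setwise stabilizer of an edge
   coincide. *)
Definition estab T (x y : T) : set G := vstab x `&` vstab y.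

Definition E_tree T :=
  is_tree T /\ forall x y : T, adj x y -> nontrivial_abelian G (estab x y).

(* Without inversions, a subgroup fixing a point of the geometric realization
   fixes a vertex. *)
Definition elliptic T H := exists x : T, H `<=` vstab x.

(* Equivariant maps between trees are taken to send vertices to vertices and to
   be linear on edges, so that they are determined by their restriction to
   vertices, which is an arbitrary equivariant map. *)
Definition dominates T T' :=
  exists f : T -> T', forall g x, f (act g x) = act g (f x).

Definition same_deformation_space T T' :=
  forall H, subgroup H -> (elliptic T H <-> elliptic T' H).

(* In a tree, the segments between vertices are the paths [x :: p] without
   repetition, of length [size p]. *)
Definition k_acylindrical T (k : nat) :=
  forall (x : T) (p : seq T), path (@adj G T) x p -> uniq (x :: p) ->
    (k < size p)%N ->
  forall g, (forall y, y \in x :: p -> act g y = y) -> g = 1.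

Definition acylindrical T := exists k, k_acylindrical T k.

Definition isomorphism T T' (f : T -> T') :=
  [/\ bijective f, forall g x, f (act g x) = act g (f x) &
      forall x y, adj (f x) (f y) = adj x y].

Lemma act_inj T (g : G) : injective (@act G T g).
Proof. by apply: (@can_inj _ _ _ (act g^-1)) => x; rewrite -actM mulVg act1. Qed.

Lemma vstab_act T (g : G) (x : T) :
  vstab (act g x) = [set h | vstab x (h ^ g)].
Proof.
apply/seteqP; split=> h; rewrite /vstab /= conjgE !actM.
  by move=> ->; rewrite -actM mulVg act1.
by move=> e; apply: (@act_inj _ g^-1); rewrite e -actM mulVg act1.
Qed.

Lemma estab_act T (g : G) (x y : T) :
  estab (act g x) (act g y) = [set h | estab x y (h ^ g)].
Proof. by rewrite /estab !vstab_act. Qed.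

Lemma generated_conj (A : set G) (g x : G) :
  generated [set h | A (h ^ g)] x -> generated A (x ^ g).
Proof.
move=> Hx B [[B1 BM] AB].
apply: (Hx [set h | B (h ^ g)]); split; last by move=> h /AB.
split=> [|a b] /=; first by rewrite conj1g.
by move=> Ba Bb; rewrite conjMg conjVg; apply: BM.
Qed.

Lemma commutation_conj (A B : set G) (g : G) :
  commutation A B -> commutation [set h | A (h ^ g)] [set h | B (h ^ g)].
Proof.
move=> AB x y /(@generated_conj (A `|` B)) Hx /(@generated_conj (A `|` B)) Hy.
by apply: (@conjg_inj _ g); rewrite !conjMg; apply: AB.
Qed.

Lemma conj_setK (A : set G) (g : G) :
  [set h | [set k | A (k ^ g)] (h ^ g^-1)] = A.
Proof. by apply/seteqP; split=> h /=; rewrite conjgKV. Qed.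

Lemma nontrivial_abelian_conj (A : set G) (g : G) :
  nontrivial_abelian G A -> nontrivial_abelian G [set h | A (h ^ g)].
Proof.
move=> [[A1 AM] Aab Anz]; split.
- split=> [|x y] /=; first by rewrite conj1g.
  by rewrite conjMg conjVg; apply: AM.
- by move=> x y Ax Ay; apply: (@conjg_inj _ g); rewrite !conjMg; apply: Aab.
- move=> e; apply: Anz; rewrite -(conj_setK A g) e.
  apply/seteqP; split=> h /=.
    by move=> /(congr1 (fun k => k ^ g)); rewrite conjgKV conj1g.
  by move=> ->; rewrite conj1g.
Qed.

Section Cylinders.
Variable T : ggraph G.

(* Edges are oriented; a cylinder contains both orientations of each of its
   edges, so sets of oriented edges encode cylinders faithfully. *)
Definition cylinder_of (e : T * T) : set (T * T) :=
  [set e' | adj e'.1 e'.2 /\ commutation (estab e.1 e.2) (estab e'.1 e'.2)].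

Definition is_cylinder : set (set (T * T)) :=
  [set Y | exists2 e, adj e.1 e.2 & Y = cylinder_of e].

Definition in_cylinder (x : T) (Y : set (T * T)) :=
  exists y, Y (x, y) \/ Y (y, x).

(* The second clause implements the convention that [T_c] is a point when [T]
   is a single point; there are no cylinders in that case. *)
Definition cyl_V0 : set T :=
  [set x | (exists Y Y', [/\ is_cylinder Y, is_cylinder Y', Y <> Y',
                             in_cylinder x Y & in_cylinder x Y'])
           \/ (forall y : T, y = x)].

Definition act_edges (g : G) (Y : set (T * T)) : set (T * T) :=
  [set (act g e.1, act g e.2) | e in Y].

Lemma act_edges1 Y : act_edges 1 Y = Y.
Proof.
apply/seteqP; split=> [_ [[u v] Yuv <-]|[u v] Yuv]; first by rewrite !act1.
by exists (u, v) => //=; rewrite !act1.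
Qed.

Lemma act_edgesM g h Y : act_edges (g * h) Y = act_edges g (act_edges h Y).
Proof.
apply/seteqP; split=> [_ [[u v] Yuv <-]|_ [_ [[u v] Yuv <-] <-]].
  by exists (act h u, act h v); [exists (u, v)|rewrite /= !actM].
by exists (u, v); rewrite //= !actM.
Qed.

Lemma act_edges_inj g : injective (act_edges g).
Proof.
by apply: (@can_inj _ _ _ (act_edges g^-1)) => Y;
   rewrite -act_edgesM mulVg act_edges1.
Qed.

Lemma cylinder_of_sub g e :
  act_edges g (cylinder_of e) `<=` cylinder_of (act g e.1, act g e.2).
Proof.
move=> _ [[u v] [/= uv comm] <-]; split; rewrite /= ?adj_act//.
by rewrite !estab_act; apply: commutation_conj.
Qed.

Lemma act_cylinder_of g e :
  act_edges g (cylinder_of e) = cylinder_of (act g e.1, act g e.2).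
Proof.
apply/seteqP; split; first exact: cylinder_of_sub.
move=> [u v] uvC; rewrite -[X in X (u, v)]act_edges1 -(mulgV g) act_edgesM in uvC.
move: uvC => [f fC <-]; exists f => //.
by move/cylinder_of_sub: fC; rewrite /= -!actM mulVg !act1; case: e.
Qed.

Lemma is_cylinder_act g Y : is_cylinder Y -> is_cylinder (act_edges g Y).
Proof.
move=> [e ee ->]; exists (act g e.1, act g e.2); rewrite /= ?adj_act//.
exact: act_cylinder_of.
Qed.

Lemma in_cylinder_act g x Y :
  in_cylinder x Y -> in_cylinder (act g x) (act_edges g Y).
Proof.
by move=> [y [Yxy|Yyx]]; exists (act g y); [left; exists (x, y)
                                           |right; exists (y, x)].
Qed.

Lemma in_cylinder_actE g x Y :
  in_cylinder (act g x) (act_edges g Y) <-> in_cylinder x Y.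
Proof.
split; last exact: in_cylinder_act.
move=> /(@in_cylinder_act g^-1).
by rewrite -actM -act_edgesM mulVg act1 act_edges1.
Qed.

Lemma cyl_V0_act g x : cyl_V0 x -> cyl_V0 (act g x).
Proof.
move=> [[Y [Y' [cY cY' YY' xY xY']]]|xT]; last first.
  by right=> y; rewrite (xT y) (xT (act g x)).
left; exists (act_edges g Y), (act_edges g Y').
by split; [exact: is_cylinder_act|exact: is_cylinder_act
          |move=> /act_edges_inj|exact: in_cylinder_act|exact: in_cylinder_act].
Qed.

Definition Tc_vertex : choiceType :=
  ({x : T | x \in cyl_V0} + {Y : set (T * T) | Y \in is_cylinder})%type.

Definition Tc_adj : rel Tc_vertex := fun a b =>
  match a, b with
  | inl x, inr Y => `[< in_cylinder (sval x) (sval Y) >]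
  | inr Y, inl x => `[< in_cylinder (sval x) (sval Y) >]
  | _, _ => false
  end.

Definition Tc_act (g : G) (a : Tc_vertex) : Tc_vertex :=
  match a with
  | inl x => inl (exist _ (act g (sval x))
                    (mem_set (cyl_V0_act g (set_mem (svalP x)))))
  | inr Y => inr (exist _ (act_edges g (sval Y))
                    (mem_set (is_cylinder_act g (set_mem (svalP Y)))))
  end.

Lemma Tc_act1 a : Tc_act 1 a = a.
Proof.
by case: a => -[a ?] /=; congr (_ _); apply: val_inj; rewrite /= ?act1 ?act_edges1.
Qed.

Lemma Tc_actM g h a : Tc_act (g * h) a = Tc_act g (Tc_act h a).
Proof.
by case: a => -[a ?] /=; congr (_ _); apply: val_inj; rewrite /= ?actM ?act_edgesM.
Qed.

Lemma Tc_adj_act g a b : Tc_adj (Tc_act g a) (Tc_act g b) = Tc_adj a b.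
Proof.
by case: a b => -[a ?] [] [b ?] //=; apply: asbool_equiv_eq;
   exact: in_cylinder_actE.
Qed.

Definition tree_of_cylinders : ggraph G := GGraph Tc_act1 Tc_actM Tc_adj_act.

End Cylinders.

(* Collapsing the edges whose stabilizer is not a non-trivial abelian group: the
   vertices of the quotient are the classes of vertices joined by a path of such
   edges, and its edges are the images of the remaining ones. *)
Section Collapse.
Variable T : ggraph G.

Definition collapsed : rel T := fun x y =>
  adj x y && ~~ `[< nontrivial_abelian G (estab x y) >].

Definition surviving : rel T := fun x y =>
  adj x y && `[< nontrivial_abelian G (estab x y) >].

Definition collapse_class (x : T) : set T :=
  [set y | exists2 p, path collapsed x p & last x p = y].

Definition is_class : set (set T) := [set C | exists x, C = collapse_class x].

Lemma nontrivial_estab_act g (x y : T) :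
  `[< nontrivial_abelian G (estab (act g x) (act g y)) >] =
  `[< nontrivial_abelian G (estab x y) >].
Proof.
apply: asbool_equiv_eq; rewrite estab_act; split.
  by move=> /(@nontrivial_abelian_conj _ g^-1); rewrite conj_setK.
exact: nontrivial_abelian_conj.
Qed.

Lemma collapsed_act g x y : collapsed (act g x) (act g y) = collapsed x y.
Proof. by rewrite /collapsed adj_act nontrivial_estab_act. Qed.

Lemma surviving_act g x y : surviving (act g x) (act g y) = surviving x y.
Proof. by rewrite /surviving adj_act nontrivial_estab_act. Qed.

Lemma collapse_class_sub g x :
  act g @` collapse_class x `<=` collapse_class (act g x).
Proof.
move=> _ [_ [p xp <-] <-]; exists (map (act g) p); last by rewrite last_map.
by rewrite path_map; apply: sub_path xp => u v; rewrite /= collapsed_act.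
Qed.

Lemma act_set1 (C : set T) : act 1 @` C = C.
Proof.
apply/seteqP; split=> [_ [x Cx <-]|x Cx]; first by rewrite act1.
by exists x; rewrite ?act1.
Qed.

Lemma act_setM g h (C : set T) : act (g * h) @` C = act g @` (act h @` C).
Proof.
apply/seteqP; split=> [_ [x Cx <-]|_ [_ [x Cx <-] <-]].
  by exists (act h x); [exists x|rewrite actM].
by exists x; rewrite ?actM.
Qed.

Lemma act_collapse_class g x :
  act g @` collapse_class x = collapse_class (act g x).
Proof.
apply/seteqP; split; first exact: collapse_class_sub.
move=> y; rewrite -[X in X y]act_set1 -(mulgV g) act_setM => -[z zC <-].
by exists z => //; move/collapse_class_sub: zC; rewrite -actM mulVg act1.
Qed.

Lemma is_class_act g C : is_class C -> is_class (act g @` C).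
Proof. by move=> [x ->]; exists (act g x); exact: act_collapse_class. Qed.

Definition collapse_vertex : choiceType := {C : set T | C \in is_class}.

Definition collapse_adj : rel collapse_vertex := fun C D =>
  `[< exists x y, [/\ sval C x, sval D y & surviving x y] >].

Definition collapse_act (g : G) (C : collapse_vertex) : collapse_vertex :=
  exist _ (act g @` sval C) (mem_set (is_class_act g (set_mem (svalP C)))).

Lemma collapse_act1 C : collapse_act 1 C = C.
Proof. by apply: val_inj; rewrite /= act_set1. Qed.

Lemma collapse_actM g h C :
  collapse_act (g * h) C = collapse_act g (collapse_act h C).
Proof. by apply: val_inj; rewrite /= act_setM. Qed.

Lemma collapse_adj_act g C D :
  collapse_adj (collapse_act g C) (collapse_act g D) = collapse_adj C D.
Proof.
apply: asbool_equiv_eq; split=> [[_ [_ [[x Cx <-] [y Dy <-]]]]|[x [y [Cx Dy]]]].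
  by rewrite surviving_act => ?; exists x, y.
by move=> xy; exists (act g x), (act g y); rewrite surviving_act; split=> //;
   [exists x|exists y].
Qed.

Definition collapse : ggraph G :=
  GGraph collapse_act1 collapse_actM collapse_adj_act.

Lemma is_class_collapse x : is_class (collapse_class x).
Proof. by exists x. Qed.

Definition collapse_map (x : T) : collapse :=
  exist _ (collapse_class x) (mem_set (is_class_collapse x)).

End Collapse.

Definition collapsed_tree_of_cylinders T : ggraph G :=
  collapse (tree_of_cylinders T).

End GGraphs.

(* Main.v *)
(* Everything is driven by two facts. In a CSA group commutation is transitive on
   non-trivial elements, so a cylinder [Y] is determined by any [a <> 1] fixing
   one of its edges, and by malnormality its stabilizer is the centralizer of
   [a]. In a tree a bounded non-empty set has a center, so whatever preserves it
   fixes a vertex. The latter shows that commuting elliptic elements have a common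
   fixed point, whence cylinders are convex and [T_c] is a tree; that the
   centralizer of [a] is elliptic in any acylindrical tree where [a] is; and, with
   the four-point condition, that an abelian group acting freely on a tree is
   cyclic, so that non-cyclic abelian groups contain some [a <> 1] elliptic in
   [T] and fix a cylinder or a vertex. *)
Require Import Defs.
From mathcomp Require Import all_boot.
From mathcomp Require Import boolp classical_sets.
From mathcomp Require Import zify.

Local Open Scope classical_set_scope.
Local Open Scope group_scope.

Set Implicit Arguments.
Unset Strict Implicit.
Unset Printing Implicit Defensive.

(** * Distance, geodesics and centers in a tree *)

Section TreeMetric.
Context {G : groupType} {T : ggraph G} (hT : is_tree T).
Local Notation adj := (@adj G T).
Implicit Types (x y z s u v w : T).

Lemma path_length_ex x y :
  exists n, `[< exists p, [/\ path adj x p, last x p = y & size p = n] >].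
Proof.
by have [p xp <-] := tree_connected hT x y; exists (size p); apply/asboolP; exists p.
Qed.

Definition dist x y := ex_minn (path_length_ex x y).

Lemma dist_path x y :
  exists p, [/\ path adj x p, last x p = y & size p = dist x y].
Proof. by rewrite /dist; case: ex_minnP => n /asboolP. Qed.

Lemma dist_le x p : path adj x p -> (dist x (last x p) <= size p)%N.
Proof.
move=> xp; rewrite /dist; case: ex_minnP => n _; apply.
by apply/asboolP; exists p.
Qed.

Lemma distxx x : dist x x = 0%N.
Proof. by have := @dist_le x [::] isT; case: dist. Qed.

Lemma dist_eq0 x y : dist x y = 0%N -> x = y.
Proof. by have [p [_ <- <-]] := dist_path x y => /size0nil->. Qed.

Lemma dist_gt0 x y : x <> y -> (0 < dist x y)%N.
Proof. by move=> xy; rewrite lt0n; apply/eqP => /dist_eq0. Qed.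

Lemma dist_sym_le x y : (dist y x <= dist x y)%N.
Proof.
have [p [xp <- <-]] := dist_path x y.
rewrite -(@size_belast _ x p) -size_rev.
suff {2}-> : x = last (last x p) (rev (belast x p)).
  by apply: dist_le; rewrite rev_path; apply: sub_path xp => a b /=;
     rewrite (tree_sym hT).
by case: p {xp} => //= a p; rewrite rev_cons last_rcons.
Qed.

Lemma distC x y : dist x y = dist y x.
Proof. by apply/eqP; rewrite eqn_leq !dist_sym_le. Qed.

Lemma dist_triangle y x z : (dist x z <= dist x y + dist y z)%N.
Proof.
have [p [xp <- <-]] := dist_path x y.
have [q [yq <- <-]] := dist_path (last x p) z.
by rewrite -last_cat -size_cat dist_le// cat_path xp.
Qed.

Lemma dist_act_le g x y : (dist (act g x) (act g y) <= dist x y)%N.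
Proof.
have [p [xp <- <-]] := dist_path x y.
rewrite -last_map -(size_map (act g)); apply: dist_le.
by rewrite path_map; apply: sub_path xp => a b /=; rewrite adj_act.
Qed.

Lemma dist_act g x y : dist (act g x) (act g y) = dist x y.
Proof.
apply/eqP; rewrite eqn_leq dist_act_le /=.
by have := dist_act_le g^-1 (act g x) (act g y); rewrite -!actM mulVg !act1.
Qed.

Lemma adj_neq x y : adj x y -> x <> y.
Proof. by move=> + xy; rewrite xy (tree_irrefl hT). Qed.

Lemma dist_adj x y : adj x y -> dist x y = 1%N.
Proof.
move=> xy; have := dist_gt0 (adj_neq xy).
by have /= := @dist_le x [:: y]; rewrite xy => /(_ isT); lia.
Qed.

Lemma dist_step x y : x <> y -> exists2 u, adj x u & dist x y = (dist u y).+1.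
Proof.
move=> xy; have [[|u p] /= [xp py pd]] := dist_path x y; first by [].
case/andP: xp => xu up; exists u => //.
have := dist_le up; rewrite py => uy.
have := dist_triangle u x y; rewrite (dist_adj xu); lia.
Qed.

Lemma geodesic x y : exists p,
  [/\ path adj x p, last x p = y, uniq (x :: p), size p = dist x y &
      forall z, z \in x :: p -> (dist x z + dist z y = dist x y)%N].
Proof.
move en: (dist x y) => n; elim: n x en => [|n IH] x xyn.
  exists [::]; split=> //=; first exact: dist_eq0.
  by move=> z; rewrite inE => /eqP->; rewrite distxx xyn.
have xy : x <> y by move=> xy; move: xyn; rewrite xy distxx.
have [u xu] := dist_step xy; rewrite xyn => -[uyn].
have [p [up py pU ps pz]] := IH u (esym uyn).
have E z : z \in u :: p -> (dist x z + dist z y = n.+1)%N.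
  move=> /pz; have := dist_triangle u x z; rewrite (dist_adj xu).
  by have := dist_triangle z x y; lia.
exists (u :: p); split=> //=.
- by rewrite xu.
- by rewrite -/(uniq (u :: p)) pU andbT; apply/negP => /pz; lia.
- by rewrite ps.
- by move=> z; rewrite inE => /orP[/eqP->|/E//]; rewrite distxx.
Qed.

(** A shortened path from [u] to [v] closes up through [x] into a cycle of at least three vertices,
    unless it is trivial. *)
Lemma adj_avoid x u v p : adj x u -> adj x v ->
  path adj u p -> last u p = v -> x \notin u :: p -> u = v.
Proof.
move=> xu xv up + xp; have [q uq qU sq qv] := shortenP up.
have {sq}xq : x \notin u :: q.
  by apply: contra xp; rewrite !inE => /orP[->//|/sq ->]; rewrite orbT.
case/lastP: q uq qU xq qv => [|q w] uq qU xq; rewrite ?last_rcons //= => wv.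
rewrite {}wv in uq qU xq.
have : ucycle adj [:: x, u & rcons q v].
  apply/andP; split; last by rewrite cons_uniq xq.
  by rewrite (cycle_path x) /= last_rcons (tree_sym hT) xv xu.
by move=> /(tree_acyclic hT); rewrite /= size_rcons.
Qed.

(* The edge from [x] towards [s] is unique, and no edge joins two points at the
   same distance of [s]: otherwise geodesics to [s] would close up a cycle. *)
Lemma toward_or_not x u v s : adj x u -> adj x v ->
  dist x s = (dist u s).+1 -> (dist v s <= dist x s)%N -> u = v.
Proof.
move=> xu xv xus vs.
have [p [up ps _ _ pd]] := geodesic u s.
have [q [vq qs _ _ qd]] := geodesic v s.
set r := rev (belast v q).
have sr : path adj s r.
  rewrite -qs rev_path; apply: sub_path vq => a b /=.
  by rewrite (tree_sym hT).
have rv : last s r = v.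
  by rewrite /r; case: (q) qs => [//|a q'] /= _; rewrite rev_cons last_rcons.
apply: (@adj_avoid x u v (p ++ r)) => //.
- by rewrite cat_path up ps sr.
- by rewrite last_cat ps rv.
rewrite -cat_cons mem_cat negb_or; apply/andP; split.
  by apply/negP => /pd; lia.
rewrite mem_rev; apply/negP => /mem_belast /qd.
by have := dist_gt0 (nesym (adj_neq xv)); lia.
Qed.

(** Trees are bipartite: by [toward_or_not], equal distances would make [u] the neighbour of [x]
    towards [s], which is strictly closer. *)
Lemma adj_dist x u s : adj x u ->
  dist u s = (dist x s).+1 \/ dist x s = (dist u s).+1.
Proof.
move=> xu; have [ux|xu'] := leqP (dist u s) (dist x s); last first.
  left; have := dist_triangle x u s; rewrite (distC u x) (dist_adj xu); lia.
right; have [xs|xs] := pselect (x = s).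
  by move: ux; rewrite xs distxx; have := dist_gt0 (adj_neq xu); rewrite xs distC; lia.
have [v xv xvs] := dist_step xs.
by rewrite -(toward_or_not xv xu xvs ux).
Qed.

(** Local geodesics are geodesics: the only neighbour of [u] towards [z] is [x], so continuing from
    [u] towards [y] keeps moving away from [z]. *)
Lemma dist_concat_step x u y z : adj x u ->
  dist x y = (dist u y).+1 -> dist u z = (dist x z).+1 ->
  dist z y = (dist z x + dist x y)%N.
Proof.
move en: (dist u y) => n; elim: n x u en => [|n IH] x u uyn xu xy uz.
  by rewrite xy -(dist_eq0 uyn) distC uz distC addn1.
have uy : u <> y by move=> e; move: uyn; rewrite e distxx.
have [v uv uvy] := dist_step uy.
have vz : dist v z = (dist u z).+1.
  have [//|vz] := adj_dist z uv.
  have ux : adj u x by rewrite (tree_sym hT).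
  by have := toward_or_not uv ux vz; rewrite uz => /(_ (leqnSn _)) e;
     move: uvy; rewrite e; lia.
have vyn : dist v y = n by lia.
by rewrite (IH _ _ vyn uv uyn vz) (distC z u) (distC z x); lia.
Qed.

Lemma dist_concat x u v y z : adj x u -> adj x v -> u <> v ->
  dist x y = (dist u y).+1 -> dist x z = (dist v z).+1 ->
  dist z y = (dist z x + dist x y)%N.
Proof.
move=> xu xv uv uy vz; apply: dist_concat_step (xu) uy _.
have [//|uz] := adj_dist z xu.
by case: uv; apply/esym/(toward_or_not xv xu vz); lia.
Qed.

(** Gromov's condition with constant 0, by moving [x] one step towards [y]. If both [z] and [w] get
    closer, induction applies; if one gets farther, [x] lies between it and [y], and the triangle
    inequality concludes. *)
Lemma four_point x y z w :
  (dist x y + dist z w <= maxn (dist x z + dist y w) (dist x w + dist y z))%N.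
Proof.
move en: (dist x y) => n; elim: n x en => [|n IH] x xyn.
  by rewrite (dist_eq0 xyn); have := dist_triangle y z w; rewrite (distC z y); lia.
have xy : x <> y by move=> e; move: xyn; rewrite e distxx.
have [u xu] := dist_step xy; rewrite xyn => -[un].
have away t : dist u t = (dist x t).+1 -> dist y t = (n.+1 + dist x t)%N.
  move=> ut; rewrite distC (@dist_concat_step x u) //; last by lia.
  by rewrite (distC t x); lia.
have := IH u (esym un); have := dist_triangle x z w; rewrite (distC z x).
have := dist_triangle y z w; rewrite (distC z y).
by case: (adj_dist z xu) => [/[dup]/away|];
   case: (adj_dist w xu) => [/[dup]/away|]; lia.
Qed.

(** By the four-point condition, [dist u s] is at most one of the end distances minus the positive
    length of a part of the segment. *)
Lemma between_strict_convex v u w s :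
  (dist v u + dist u w = dist v w)%N -> v <> u -> u <> w ->
  (dist u s < maxn (dist v s) (dist w s))%N.
Proof.
move=> vuw /dist_gt0 vu /dist_gt0 uw.
have := four_point v w u s; rewrite (distC w u); lia.
Qed.

(** Fixed sets are convex: [u] and [act a u] have the same distances to both ends, and the
    four-point condition makes them coincide. *)
Lemma between_fixed (a : G) x u y : act a x = x -> act a y = y ->
  (dist x u + dist u y = dist x y)%N -> act a u = u.
Proof.
move=> ax ay xuy; apply/esym/dist_eq0.
have := four_point x y u (act a u).
have xau : dist x (act a u) = dist x u by rewrite -[in LHS]ax dist_act.
have yau : dist y (act a u) = dist y u by rewrite -[in LHS]ay dist_act.
by rewrite xau yau (distC y u); lia.
Qed.

(* The vertices minimizing the distance to the farthest point of [S] are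
   pairwise equal or adjacent, by strict convexity. *)
Lemma bounded_fixed (S : set T) x0 n : S !=set0 ->
  (forall s, S s -> (dist x0 s <= n)%N) ->
  exists v, forall h : G, (forall s, S (act h s) <-> S s) -> act h v = v.
Proof.
move=> [s0 Ss0] Sn.
have ex : exists n, `[< exists v, forall s, S s -> (dist v s <= n)%N >].
  by exists n; apply/asboolP; exists x0.
case: (ex_minnP ex) => r /asboolP[v vr] rmin.
pose C := [set v | forall s, S s -> (dist v s <= r)%N].
have Cact h : (forall s, S (act h s) <-> S s) -> forall w, C w -> C (act h w).
  move=> hS w Cw s Ss; rewrite -[s]act1 -(mulgV h) actM dist_act; apply: Cw.
  by apply/hS; rewrite -actM mulgV act1.
have Cadj w w' : C w -> C w' -> w <> w' -> adj w w'.
  move=> Cw Cw' ww'; have [u wu wuw'] := dist_step ww'.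
  have [<-//|uw'] := pselect (u = w').
  (* An intermediate vertex [u] would give a smaller radius; only [r = 0] escapes, and then [w] and
     [w'] both equal [s0]. *)
  suff : (r <= r.-1)%N.
    move=> r0; have := Cw' _ Ss0; have := Cw _ Ss0.
    have -> : r = 0%N by lia.
    by rewrite !leqn0 => /eqP/dist_eq0 e /eqP/dist_eq0 e'; case: ww'; rewrite e e'.
  apply/rmin/asboolP; exists u => s Ss.
  have := @between_strict_convex w u w' s; rewrite (dist_adj wu) add1n -wuw'.
  move=> /(_ erefl (adj_neq wu) uw'); have := Cw _ Ss; have := Cw' _ Ss; lia.
exists v => h hS; apply: contrapT => hv.
have Chv := Cact _ hS _ vr; have Chhv := Cact _ hS _ Chv.
have vhv := Cadj _ _ vr Chv (nesym hv).
have hhv : act h (act h v) <> act h v by move=> /act_inj.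
(* Either [h] inverts the edge from [v] to [act h v], or the first three iterates of [v] form a
   triangle. *)
have [e|nvhhv] := pselect (act h (act h v) = v).
  exact: (tree_no_inversion hT vhv (conj erefl e)).
have : ucycle adj [:: v; act h v; act h (act h v)].
  rewrite /ucycle /= vhv (Cadj _ _ Chv Chhv (nesym hhv)) (Cadj _ _ Chhv vr nvhhv) /=.
  by rewrite !inE !andbT negb_or; apply/andP; split; [apply/andP; split|]; apply/eqP;
    [exact: nesym|exact: nesym|exact: nesym].
by move=> /(tree_acyclic hT).
Qed.

End TreeMetric.

(** * Subgroups and commutation in CSA groups *)

Section CSAGroups.
Context {G : groupType} (hcsa : CSA G).
Implicit Types (a b x g h : G) (A B : set G).

Lemma sub_generated A : A `<=` generated A.
Proof. by move=> x Ax B [_]; apply. Qed.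

Lemma generated_sub A B : subgroup B -> A `<=` B -> generated A `<=` B.
Proof. by move=> hB AB x; apply. Qed.

Lemma subgroup_generated A : subgroup (generated A).
Proof.
split=> [B [[]]//|x y Ax Ay B hB].
by have [[_ BM] _] := hB; apply: BM; [exact: Ax|exact: Ay].
Qed.

Lemma subgroupV A x : subgroup A -> A x -> A x^-1.
Proof. by move=> [A1 AM] Ax; rewrite -[_^-1]mul1g; apply: AM. Qed.

Lemma subgroupM A x y : subgroup A -> A x -> A y -> A (x * y).
Proof.
move=> hA Ax Ay; rewrite -[y]invgK; have [_ AM] := hA.
by apply: AM => //; apply: subgroupV.
Qed.

Lemma subgroup_centralizer a : subgroup (centralizer a).
Proof.
split=> [|x y]; first exact: commute1.
by move=> ax ay; apply: commuteM => //; apply: commuteV.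
Qed.

Lemma subgroup_nontrivial A : subgroup A -> A <> [set 1] ->
  exists2 a, A a & a <> 1.
Proof.
move=> [A1 _] An; apply: contrapT => nA; apply: An.
apply/seteqP; split=> [a Aa|_ ->//]; apply: contrapT => a1; apply: nA.
by exists a.
Qed.

Lemma commute_trans x a b : x <> 1 -> commute x a -> commute x b -> commute a b.
Proof. by move=> x1 xa xb; apply: (hcsa.1 _ x1). Qed.

Lemma maximal_abelian_centralizer a : a <> 1 -> maximal_abelian (centralizer a).
Proof.
move=> a1; split; [exact: subgroup_centralizer|exact: hcsa.1|].
move=> B _ Bab aB; apply/seteqP; split=> // b Bb; apply: Bab => //.
exact/aB/commute_refl.
Qed.

(** The non-trivial element [a ^ g] lies in the centralizer of [a] and in its conjugate by [g], so
    malnormality applies. *)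
Lemma commute_conj a g : a <> 1 -> commute a (a ^ g) -> commute a g.
Proof.
move=> a1 aag; apply: (hcsa.2 _ (maximal_abelian_centralizer a1)) => e.
apply: a1; apply: (@conjg_inj _ g); rewrite conj1g.
suff : [set 1] (a ^ g) by [].
by rewrite -e; split=> //; exists a => //; apply: commute_refl.
Qed.

(** One commuting pair suffices: by transitivity it puts [A] and [B] inside the abelian centralizer
    of [a]. *)
Lemma commutationP A B a b : nontrivial_abelian G A -> nontrivial_abelian G B ->
  A a -> B b -> a <> 1 -> b <> 1 -> commutation A B <-> commute a b.
Proof.
move=> [_ Aab _] [_ Bab _] Aa Bb a1 b1; split=> [|ab].
  by apply; apply: sub_generated; [left|right].
have AB : generated (A `|` B) `<=` centralizer a.
  apply: generated_sub; first exact: subgroup_centralizer.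
  by move=> x [/Aab-/(_ _ Aa)/commute_sym//|Bx]; apply: (commute_trans b1);
     [exact: commute_sym|exact: Bab].
by move=> x y /AB ax /AB ay; apply: commute_trans ay.
Qed.

End CSAGroups.

(** * Stabilizers and construction of equivariant maps *)

Section Actions.
Context {G : groupType}.
Implicit Types (T : ggraph G) (a b g h : G).

Lemma subgroup_vstab T (x : T) : subgroup (vstab x).
Proof.
split=> [|g h gx hx]; rewrite /vstab /= ?act1// actM -[in RHS]gx.
by congr act; rewrite -[in LHS]hx -actM mulVg act1.
Qed.

Lemma act_commute T g a (x : T) : commute g a -> act g x = x ->
  act g (act a x) = act a x.
Proof. by move=> ga gx; rewrite -actM ga actM gx. Qed.

Lemma equivariant_map_exists T T' :
  (forall x : T, exists x' : T', vstab x `<=` vstab x') -> dominates T T'.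
Proof.
move=> /choice[phi phiP].
pose orbit (x : T) : set T := [set y | exists g, y = act g x].
have orbit_act g x : orbit (act g x) = orbit x.
  apply/seteqP; split=> _ [h ->]; first by exists (h * g); rewrite actM.
  by exists (h * g^-1); rewrite actM -(actM g^-1) mulVg act1.
have orbitxx x : orbit x x by exists 1; rewrite act1.
(* The result of [choose] is the same from every point of the orbit, so [r] selects one
   representative per orbit. *)
pose r x := choose (fun y => `[< orbit x y >]) x.
have r_act g x : r (act g x) = r x.
  rewrite /r orbit_act; apply: choose_id; apply/asboolP; first by exists g.
  exact: orbitxx.
have /choice[c cP] x : exists g, x = act g (r x).
  have /asboolP[g rx] :=
    @chooseP _ (fun y => `[< orbit x y >]) x (asboolT (orbitxx x)).
  by exists g^-1; rewrite /r rx -actM mulVg act1.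
exists (fun x => act (c x) (phi (r x))) => g x; rewrite r_act -actM.
(* Both [c (act g x)] and [g * c x] carry [r x] to [act g x]; their quotient fixes [r x], hence also
   [phi (r x)]. *)
have : vstab (r x) ((c (act g x))^-1 * (g * c x)).
  rewrite /vstab /= !actM -cP.
  by rewrite [X in act _ X](_ : _ = act (c (act g x)) (r x)) -?actM ?mulVg
     ?act1// -[in RHS](r_act g) -cP.
move=> /phiP; rewrite /vstab /= => e.
by rewrite -[in LHS]e -actM mulgA mulgV mul1g.
Qed.

End Actions.

(** * Fixed points of abelian groups acting on trees *)

Section FixedPoints.
Context {G : groupType} {T : ggraph G} (hT : is_tree T).
Local Notation adj := (@adj G T).
Local Notation dist := (dist hT).
Implicit Types (x y z s u v w : T) (a b c g h : G).

Lemma act_stable_iff (S : set T) h : (forall s, S s -> S (act h s)) ->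
  (forall s, S s -> S (act h^-1 s)) -> forall s, S (act h s) <-> S s.
Proof.
move=> Sh ShV s; split; last exact: Sh.
by move=> /ShV; rewrite -actM mulVg act1.
Qed.

(* The points fixed by [a] at a given distance of [y] form a bounded set, which
   is preserved by both elements. *)
Lemma commute_common_fixed a b x y : commute a b ->
  act a x = x -> act b y = y -> exists2 z : T, act a z = z & act b z = z.
Proof.
move=> ab ax by_.
pose S := [set z : T | act a z = z /\ dist y z = dist y x].
have [|z|z zP] := @bounded_fixed _ _ hT S y (dist y x); first by exists x.
  by move=> [_ ->].
have SV c : commute a c -> act c y = y -> forall s, S s -> S (act c s).
  by move=> ac cy s [as_ ys]; split; [exact: act_commute|rewrite -{1}cy dist_act].
exists z; apply: zP; apply: act_stable_iff => s.
- by move=> Ss; have [-> _] := Ss.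
- by move=> Ss; have [as_ _] := Ss; rewrite -as_ -actM mulVg act1.
- exact: SV.
- by apply: SV; [exact: commuteV|rewrite -{1}by_ -actM mulVg act1].
Qed.

(** A common fixed point [z] lies on one side of the edge, which is therefore on the segment from
    [x] to [z] or on the one from [z] to [y]. *)
Lemma between_edge_fixed a b x y u v : commute a b ->
  act a x = x -> act b y = y -> adj u v ->
  dist x v = (dist x u).+1 -> dist u y = (dist v y).+1 ->
  (dist x u + dist u y = dist x y)%N ->
  estab u v a \/ estab u v b.
Proof.
move=> ab ax by_ uv xv uy xuy.
have [z az bz] := commute_common_fixed ab ax by_.
have vu : adj v u by rewrite (tree_sym hT).
have xvu : dist v x = (dist u x).+1 by rewrite distC xv distC.
have [zv|zu] := adj_dist hT z uv.
- right; have yz := dist_concat_step vu zv uy.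
  split; apply: (between_fixed by_ bz); rewrite yz //.
  by rewrite zv (distC hT y u) uy (distC hT y v) addnS addSn.
- left; have xz := dist_concat_step uv zu xvu.
  split; apply: (between_fixed ax az); rewrite xz //.
  by rewrite xv zu addnS addSn.
Qed.

(** Some positive power of [b] fixes [x], so the orbit of [x] under [b] is finite and has a
    center. *)
Lemma cyclic_fixed b a x : generated [set b] a -> a <> 1 -> act a x = x ->
  elliptic T (generated [set b]).
Proof.
move=> ba a1 ax.
(* With natural exponents, elements of the cyclic group are quotients of two powers of [b]. *)
pose P := [set z | exists m n, z * b ^+ n = b ^+ m].
have [m [n abn]] : P a.
  apply: generated_sub ba; last by move=> _ ->; exists 1%N, 0%N; rewrite mulg1.
  split=> [|y z [m [n yn]] [m' [n' zn']]]; first by exists 0%N, 0%N; rewrite mulg1.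
  exists (m + n')%N, (m' + n)%N.
  by rewrite expgnDr -zn' -!mulgA mulKg -expgnDr addnC expgnDr mulgA yn -expgnDr.
have [k k0 bk] : exists2 k, (0 < k)%N & act (b ^+ k) x = x.
  have [mn|nm|mn] := ltngtP m n.
  - exists (n - m)%N; first by rewrite subn_gt0.
    suff e : a * b ^+ (n - m) = 1.
      by apply: (@act_inj _ _ a); rewrite -actM e act1 ax.
    by apply: (mulIg (b ^+ m)); rewrite -mulgA -expgnDr subnK 1?ltnW// mul1g.
  - exists (m - n)%N; first by rewrite subn_gt0.
    rewrite -[RHS]ax; congr act.
    by apply: (mulIg (b ^+ n)); rewrite abn -expgnDr subnK 1?ltnW.
  - by case: a1; apply: (mulIg (b ^+ n)); rewrite mul1g abn mn.
pose S := [set y : T | exists i, y = act (b ^+ i) x].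
have bkq q : act (b ^+ (q * k)) x = x.
  by elim: q => [|q IH]; rewrite ?act1// mulSn expgnDr actM IH bk.
have [|_ [i ->]|v vP] := @bounded_fixed _ _ hT S x (k * dist x (act b x)).
- by exists x; exists 0%N; rewrite act1.
- rewrite (divn_eq i k) addnC expgnDr actM bkq.
  have : (i %% k <= k)%N by rewrite ltnW// ltn_pmod.
  move: (i %% k)%N => r rk; apply: leq_trans (leq_mul rk (leqnn _)).
  elim: {i k k0 bk bkq rk}r => [|r IH]; first by rewrite act1 distxx.
  apply: leq_trans (dist_triangle hT (act b x) _ _) _; rewrite mulSn.
  by rewrite leq_add2l expgS actM dist_act.
exists v; apply: generated_sub; first exact: subgroup_vstab.
move=> _ ->; apply: vP; apply: act_stable_iff => _ [i ->].
  by exists i.+1; rewrite expgS actM.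
(* On this orbit [b^-1] acts as [b ^+ k.-1]. *)
exists (i + k.-1)%N; rewrite -[in LHS]bk -!actM; congr act.
by rewrite -{1}(prednK k0) -?mulgA -expgnDr addnS expgS mulKg.
Qed.

(* For [b] of minimal displacement at [x] and [c] outside of [<b>], the
   four-point condition shows that the points of [<b> c x] nearest to [x] are
   permuted by [b], so that [b] has a bounded orbit. *)
Lemma free_abelian_cyclic A : subgroup A -> abelian A ->
  (forall a x, A a -> act a x = x -> a = 1) -> cyclic A.
Proof.
move=> hA Aab Afree; have [x _] := tree_nonempty hT.
have [A1|/(subgroup_nontrivial hA)[a Aa a1]] := pselect (A = [set 1]).
  exists 1; rewrite A1; apply/seteqP; split; first exact: sub_generated.
  by apply: generated_sub => //; split=> // _ _ -> ->; rewrite /= divg1.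
pose disp n := `[< exists b, [/\ A b, b <> 1 & dist x (act b x) = n] >].
have ex : exists n, disp n by exists (dist x (act a x)); apply/asboolP; exists a.
case: (ex_minnP ex) => l /asboolP[b [Ab b1 bl]] lmin {ex a Aa a1}.
have bA : generated [set b] `<=` A by apply: generated_sub => // _ ->.
exists b; apply/seteqP; split=> // c Ac; apply: contrapT => cb.
pose cdist n := `[< exists2 g, generated [set b] g & dist x (act (g * c) x) = n >].
have ex : exists n, cdist n.
  exists (dist x (act c x)); apply/asboolP; exists 1; last by rewrite mul1g.
  exact: (subgroup_generated _).1.
case: (ex_minnP ex) => D /asboolP[g0 bg0 g0D] Dmin {ex}.
have D_le g : generated [set b] g -> (D <= dist x (act (g * c) x))%N.
  by move=> bg; apply/Dmin/asboolP; exists g.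
have lD : (l <= D)%N.
  apply/lmin/asboolP; exists (g0 * c); split=> //.
    by apply: subgroupM => //; apply: bA.
  move=> g0c; apply: cb; rewrite -[c](mulKg g0) g0c mulg1.
  exact: subgroupV (subgroup_generated _) bg0.
pose S := [set y : T |
  exists g, [/\ generated [set b] g, y = act (g * c) x & dist x y = D]].
have stable h : generated [set b] h -> dist x (act h x) = l ->
    forall y, S y -> S (act h y).
  move=> bh hl _ [g [bg -> gD]]; exists (h * g).
  have bhg := subgroupM (subgroup_generated _) bh bg.
  split=> //; rewrite -?actM ?mulgA//.
  have gch : commute (g * c) h.
    by apply: Aab; [apply: subgroupM => //|]; apply: bA.
  have hgl : dist (act (h * g * c) x) (act (g * c) x) = l.
    by rewrite -mulgA -gch actM dist_act distC.
  have hgD : dist (act (h * g * c) x) (act h x) = D.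
    by rewrite -mulgA actM dist_act distC.
  have : (D <= dist (act (g * c) x) (act h x))%N.
    rewrite distC -(dist_act hT h^-1) -!actM mulVg act1 mulgA; apply: D_le.
    have bV := subgroupV (subgroup_generated _) bh.
    exact: (subgroupM (subgroup_generated _) bV bg).
  (* The right side is the maximum of [D + D] and [l + l], that is [D + D], while both distances on
     the left are at least [D]; hence both equal [D]. *)
  have := four_point hT x (act (h * g * c) x) (act (g * c) x) (act h x).
  have := D_le _ bhg; rewrite gD hgl hgD hl.
  by move: (dist x (act (h * g * c) x)) (dist _ (act h x)) => X Y; lia.
have bb : generated [set b] b by apply: (@sub_generated _ [set b]).
have [|_ [g [_ -> ->]]//|v vP] := @bounded_fixed _ _ hT S x D.
  by exists (act (g0 * c) x); exists g0.
apply/b1/(Afree _ v Ab)/vP; apply: act_stable_iff; apply: stable => //.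
  exact: (subgroupV (subgroup_generated _) bb).
by rewrite -(dist_act hT b) -actM mulgV act1 distC.
Qed.

(** Since [a] fixes the segments between its fixed points, these are within distance [k] of each
    other; [A] preserves this bounded set, hence fixes a center. *)
Lemma acylindrical_fixed A a : acylindrical T -> A `<=` centralizer a ->
  a <> 1 -> (exists x : T, act a x = x) -> elliptic T A.
Proof.
move=> [k Tk] Aa a1 [x ax].
pose S := [set z : T | act a z = z].
have [|z az|z zP] := @bounded_fixed _ _ hT S x k; first by exists x.
  rewrite leqNgt; apply/negP => kxz.
  have [p [xp pz pU ps pd]] := geodesic hT x z.
  apply: a1; apply: (Tk _ _ xp pU); first by rewrite ps.
  by move=> w /pd; apply: between_fixed.
exists z => c /Aa ac; apply: zP; apply: act_stable_iff => s; apply: act_commute => //.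
exact: commuteV.
Qed.

End FixedPoints.

(** * Cylinders: membership, convexity and stabilizers *)

Section CylinderTree.
Context {G : groupType} (hcsa : CSA G) {T : ggraph G} (hT : E_tree T).
Local Notation adj := (@adj G T).
Local Notation dist := (dist hT.1).
Implicit Types (x y z u v w : T) (Y Z : set (T * T)) (a b g : G).

Lemma edge_elt x y : adj x y -> exists2 a, estab x y a & a <> 1.
Proof.
by move=> /hT.2[? _ ?]; apply: subgroup_nontrivial.
Qed.

Lemma cylinder_adj Y x y : is_cylinder Y -> Y (x, y) -> adj x y.
Proof. by move=> [e _ ->] []. Qed.

Lemma in_cylinder_of x y : adj x y -> cylinder_of (x, y) (x, y).
Proof.
move=> xy; have [a xya a1] := edge_elt xy; have nxy := hT.2 _ _ xy.
by split=> //=; apply/(commutationP hcsa nxy nxy xya xya a1 a1)/commute_refl.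
Qed.

Lemma is_cylinder_of x y : adj x y -> is_cylinder (cylinder_of (x, y)).
Proof. by move=> xy; exists (x, y). Qed.

(** Any edge of [Y] and any non-trivial element fixing it serve as reference, instead of the edge
    defining [Y]. *)
Lemma mem_cylinderE Y x y x' y' a a' : is_cylinder Y ->
  Y (x, y) -> estab x y a -> a <> 1 ->
  adj x' y' -> estab x' y' a' -> a' <> 1 -> Y (x', y') <-> commute a a'.
Proof.
move=> [[u v] /= uv ->] [/= xy uvxy] xya a1 xy' xya' a'1.
have [b uvb b1] := edge_elt uv.
have nuv := hT.2 _ _ uv; have nxy := hT.2 _ _ xy; have nxy' := hT.2 _ _ xy'.
move/(commutationP hcsa nuv nxy uvb xya b1 a1): uvxy => ba.
rewrite /cylinder_of /=; have E := commutationP hcsa nuv nxy' uvb xya' b1 a'1.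
split=> [[_ /E ba']|aa']; first exact: commute_trans ba ba'.
by split=> //; apply/E/(commute_trans hcsa a1) => //; apply: commute_sym.
Qed.

Lemma cylinder_eq Y Z x y : is_cylinder Y -> is_cylinder Z ->
  Y (x, y) -> Z (x, y) -> Y = Z.
Proof.
move=> cY cZ Yxy Zxy; have xy := cylinder_adj cY Yxy.
have [a xya a1] := edge_elt xy.
apply/seteqP; split=> -[u v] uv.
  have uv' := cylinder_adj cY uv; have [b uvb b1] := edge_elt uv'.
  by apply/(mem_cylinderE cZ Zxy xya a1 uv' uvb b1)
     /(mem_cylinderE cY Yxy xya a1 uv' uvb b1).
have uv' := cylinder_adj cZ uv; have [b uvb b1] := edge_elt uv'.
by apply/(mem_cylinderE cY Yxy xya a1 uv' uvb b1)
     /(mem_cylinderE cZ Zxy xya a1 uv' uvb b1).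
Qed.

Lemma cylinder_sym Y x y : is_cylinder Y -> Y (x, y) -> Y (y, x).
Proof.
move=> cY Yxy; have xy := cylinder_adj cY Yxy.
have [a [xa ya] a1] := edge_elt xy; have yx : adj y x by rewrite (tree_sym hT.1).
by apply/(mem_cylinderE cY Yxy (conj xa ya) a1 yx (conj ya xa) a1)/commute_refl.
Qed.

Lemma in_cylinderP x Y : is_cylinder Y -> in_cylinder x Y ->
  exists y a, [/\ Y (x, y), estab x y a & a <> 1].
Proof.
move=> cY [y [Yxy|/(cylinder_sym cY) Yxy]];
  by have [a ? ?] := edge_elt (cylinder_adj cY Yxy); exists y, a.
Qed.

(** Elements fixing edges of [Y] at [x] and at [x'] commute, so one of them fixes the edge from [u]
    to [v], which puts it in [Y]. *)
Lemma cylinder_convex Y x x' u v : is_cylinder Y ->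
  in_cylinder x Y -> in_cylinder x' Y -> adj u v ->
  dist x v = (dist x u).+1 -> dist u x' = (dist v x').+1 ->
  (dist x u + dist u x' = dist x x')%N -> Y (u, v).
Proof.
move=> cY /(in_cylinderP cY)[y [a [Yxy [xa ya] a1]]].
move=> /(in_cylinderP cY)[y' [a' [Yxy' [xa' ya'] a'1]]] uv xv ux' xux'.
have xy' := cylinder_adj cY Yxy'.
have aa' : commute a a'.
  exact/(mem_cylinderE cY Yxy (conj xa ya) a1 xy' (conj xa' ya') a'1).
have [uva|uva'] := between_edge_fixed aa' xa xa' uv xv ux' xux'.
  exact/(mem_cylinderE cY Yxy (conj xa ya) a1 uv uva a1)/commute_refl.
exact/(mem_cylinderE cY Yxy' (conj xa' ya') a'1 uv uva' a'1)/commute_refl.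
Qed.

Lemma cylinder_toward Y x x' u : is_cylinder Y ->
  in_cylinder x Y -> in_cylinder x' Y -> adj x u ->
  dist x x' = (dist u x').+1 -> Y (x, u).
Proof.
move=> cY xY x'Y xu xx'; apply: (cylinder_convex cY xY x'Y xu _ xx').
  by rewrite distxx (dist_adj hT.1 xu).
by rewrite distxx.
Qed.

(** If [g] preserves [Y], the conjugate [a ^ g^-1] fixes an edge of [Y], so it commutes with [a] and
    [commute_conj] applies. If [g] commutes with [a], then [a] also fixes the translated edge. *)
Lemma cylinder_stabE Y x y a g : is_cylinder Y -> Y (x, y) -> estab x y a ->
  a <> 1 -> act_edges g Y = Y <-> commute a g.
Proof.
move=> cY Yxy xya a1; have xy := cylinder_adj cY Yxy.
have gxy : adj (act g x) (act g y) by rewrite adj_act.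
have gYxy : act_edges g Y (act g x, act g y) by exists (x, y).
split=> [gY|ag].
  have e : estab (act g x) (act g y) (a ^ g^-1).
    by rewrite estab_act /= conjgKV.
  have a1' : a ^ g^-1 <> 1 by move=> /eqP; rewrite conjg_eq1 => /eqP.
  rewrite gY in gYxy.
  rewrite -[g]invgK; apply: commuteV; apply: (commute_conj hcsa a1).
  exact/(mem_cylinderE cY Yxy xya a1 gxy e a1').
have e : estab (act g x) (act g y) a.
  by rewrite estab_act /= conjgE ag mulKg.
apply: (cylinder_eq (is_cylinder_act g cY) cY gYxy).
exact/(mem_cylinderE cY Yxy xya a1 gxy e a1)/commute_refl.
Qed.

(** * Vertices of [Tc] and their stabilizers *)

Local Notation Tc := (tree_of_cylinders T).

Definition cyl_vertex Y (cY : is_cylinder Y) : Tc := inr (exist _ Y (mem_set cY)).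
Definition V0_vertex x (x0 : cyl_V0 x) : Tc := inl (exist _ x (mem_set x0)).

Lemma Tc_ind (P : Tc -> Prop) : (forall x (x0 : cyl_V0 x), P (V0_vertex x0)) ->
  (forall Y (cY : is_cylinder Y), P (cyl_vertex cY)) -> forall t, P t.
Proof.
move=> P0 P1 [[x xP]|[Y YP]].
  by rewrite (_ : inl _ = V0_vertex (set_mem xP)) //; congr inl; apply: val_inj.
by rewrite (_ : inr _ = cyl_vertex (set_mem YP)) //; congr inr; apply: val_inj.
Qed.

Lemma adj_V0_cyl x (x0 : cyl_V0 x) Y (cY : is_cylinder Y) :
  Defs.adj (V0_vertex x0) (cyl_vertex cY) <-> in_cylinder x Y.
Proof. by split=> [/asboolP|?] //; apply/asboolP. Qed.

Lemma vstab_V0 x (x0 : cyl_V0 x) : vstab (V0_vertex x0) = vstab x.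
Proof.
apply/seteqP; split=> g; rewrite /vstab /=; first by case.
by move=> gx; congr inl; apply: val_inj.
Qed.

Lemma vstab_cyl Y (cY : is_cylinder Y) g :
  vstab (cyl_vertex cY) g <-> act_edges g Y = Y.
Proof.
rewrite /vstab /=; split; first by case.
by move=> gY; congr inr; apply: val_inj.
Qed.

Lemma vstab_cyl_centralizer Y (cY : is_cylinder Y) x y a :
  Y (x, y) -> estab x y a -> a <> 1 -> vstab (cyl_vertex cY) = centralizer a.
Proof.
move=> Yxy xya a1; apply/seteqP; split=> g.
  by move=> /vstab_cyl/(cylinder_stabE _ cY Yxy xya a1).
by move=> /(cylinder_stabE _ cY Yxy xya a1)/vstab_cyl; apply.
Qed.

Lemma cylinder_elt Y : is_cylinder Y ->
  exists x y a, [/\ adj x y, Y (x, y), estab x y a & a <> 1].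
Proof.
move=> cY; have [[x y] /= xy YE] := cY; have [a xya a1] := edge_elt xy.
by exists x, y, a; split=> //; rewrite YE; apply: in_cylinder_of.
Qed.

Lemma V0_of_two_cylinders x Y Z : is_cylinder Y -> is_cylinder Z -> Y <> Z ->
  in_cylinder x Y -> in_cylinder x Z -> cyl_V0 x.
Proof. by move=> *; left; exists Y, Z. Qed.

(** Such an [x] has an edge and lies in only one cylinder, which its stabilizer must preserve. *)
Lemma notV0_vstab x : ~ cyl_V0 x ->
  exists Y (cY : is_cylinder Y), vstab x `<=` vstab (cyl_vertex cY).
Proof.
move=> x0; have [y yx] : exists y, y <> x.
  by apply: contrapT => nE; apply: x0; right=> y; apply: contrapT => yx;
     apply: nE; exists y.
have [u xu _] := dist_step hT.1 (nesym yx).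
have cY := is_cylinder_of xu; exists _, cY => g gx; apply/vstab_cyl.
have xY : in_cylinder x (cylinder_of (x, u)) by exists u; left; apply: in_cylinder_of.
apply: contrapT => gY; apply: x0.
apply: (V0_of_two_cylinders (is_cylinder_act g cY) cY gY _ xY).
by rewrite -[X in in_cylinder X]gx; apply: in_cylinder_act.
Qed.

(** * [Tc] is a tree *)

Lemma Tc_adj_sym : symmetric (@Defs.adj G Tc).
Proof. by move=> [?|?] [?|?]. Qed.

Definition linked (s t : Tc) := exists2 p, path (@Defs.adj G Tc) s p & last s p = t.

Lemma linked_trans t s r : linked s t -> linked t r -> linked s r.
Proof.
by move=> [p sp <-] [q tq <-]; exists (p ++ q); rewrite ?cat_path ?sp ?last_cat.
Qed.

Lemma linked_adj s t : Defs.adj s t -> linked s t.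
Proof. by move=> st; exists [:: t] => //=; apply/andP. Qed.

Lemma linked_meet Y Z (cY : is_cylinder Y) (cZ : is_cylinder Z) x :
  in_cylinder x Y -> in_cylinder x Z -> linked (cyl_vertex cY) (cyl_vertex cZ).
Proof.
move=> xY xZ; have [YZ|YZ] := pselect (Y = Z).
  by exists [::] => //=; congr inr; apply: val_inj.
have x0 := V0_of_two_cylinders cY cZ YZ xY xZ.
apply: (@linked_trans (V0_vertex x0)); apply: linked_adj.
  by rewrite Tc_adj_sym; apply/adj_V0_cyl.
exact/adj_V0_cyl.
Qed.

(** Along a path of [T] from [Y] to [Z], the cylinders of consecutive edges share a vertex. *)
Lemma linked_cylinders Y Z (cY : is_cylinder Y) (cZ : is_cylinder Z) :
  linked (cyl_vertex cY) (cyl_vertex cZ).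
Proof.
have [x [y [_ [_ Yxy _ _]]]] := cylinder_elt cY.
have [z [w [_ [_ Zzw _ _]]]] := cylinder_elt cZ.
have xY : in_cylinder x Y by exists y; left.
have zZ : in_cylinder z Z by exists w; left.
have [p xp pz] := tree_connected hT.1 x z.
elim: p => [|v p IH] /= in x Y cY xY xp pz {Yxy} *.
  by apply: (@linked_meet _ _ _ _ x) => //; rewrite pz.
case/andP: xp => xv vp; have cV := is_cylinder_of xv.
have V := in_cylinder_of xv.
apply: (@linked_trans (cyl_vertex cV)).
  by apply: (@linked_meet _ _ _ _ x) => //; exists v; left.
by apply: (IH v) => //; exists x; right.
Qed.

Lemma Tc_point (s t : Tc) : (forall x y, x = y) -> s = t.
Proof.
move=> T1; have no_cyl Y : ~ is_cylinder Y.
  by move=> [[x y] /= /(adj_neq hT.1)]; rewrite (T1 x y).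
elim/Tc_ind: s => [x x0|Y /no_cyl//]; elim/Tc_ind: t => [y y0|Y /no_cyl//].
by congr inl; apply: val_inj => /=.
Qed.

Lemma linked_cylinder (t : Tc) : (forall x y, x = y) \/
  exists Y (cY : is_cylinder Y), linked t (cyl_vertex cY) /\ linked (cyl_vertex cY) t.
Proof.
elim/Tc_ind: t => [x x0|Y cY]; last by right; exists Y, cY; split; exists [::].
have [[Y [_ [cY _ _ xY _]]]|xT] := x0; last by left=> y z; rewrite (xT y) (xT z).
right; exists Y, cY; split; apply: linked_adj; last rewrite Tc_adj_sym;
  exact/adj_V0_cyl.
Qed.

Lemma Tc_connected (s t : Tc) : linked s t.
Proof.
have [/(Tc_point s t)->|[Y [cY [sY _]]]] := linked_cylinder s; first by exists [::].
have [/(Tc_point s t)->|[Z [cZ [_ Zt]]]] := linked_cylinder t; first by exists [::].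
exact: linked_trans sY (linked_trans (linked_cylinders cY cZ) Zt).
Qed.

Lemma Tc_nonempty : exists t : Tc, True.
Proof.
have [x _] := tree_nonempty hT.1; have [x0|/notV0_vstab[Y [cY _]]] := pselect (cyl_V0 x).
  by exists (V0_vertex x0).
by exists (cyl_vertex cY).
Qed.

(* A path of [T_c] without backtracking, read as a concatenation of geodesics of
   [T] in which consecutive segments lie in distinct cylinders, is a geodesic. *)
Lemma Tc_no_return n x0 (v0 : cyl_V0 x0) x (vx : cyl_V0 x) Y (cY : is_cylinder Y)
    u (r : seq Tc) : (size r <= n)%N ->
  adj x u -> dist x x0 = (dist u x0).+1 -> Y (x, u) ->
  path (@Defs.adj G Tc) (V0_vertex vx) r ->
  uniq [:: cyl_vertex cY, V0_vertex vx & r] ->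
  ~~ Defs.adj (last (V0_vertex vx) r) (V0_vertex v0).
Proof.
(* The path is consumed two vertices at a time, hence the bound [n]. Invariant: the edge from [x]
   back towards [x0] lies in the cylinder [Y] just left. *)
elim: n r x vx Y cY u => [|n IH] [|s r] // x vx Y cY u /= rn xu xx0 Yxu.
elim/Tc_ind: s => [//|Y1 cY1] /= /andP[/(adj_V0_cyl vx cY1) xY1].
case: r rn => [_ _|s r].
  rewrite /= !inE andbT negb_or => /andP[_ /eqP YY1].
  apply/negP => /(adj_V0_cyl v0 cY1) x0Y1; apply: YY1; congr inr; apply: val_inj => /=.
  exact: (cylinder_eq cY cY1 Yxu (cylinder_toward cY1 xY1 x0Y1 xu xx0)).
elim/Tc_ind: s => [x1 vx1|//] /= rn /andP[/(adj_V0_cyl vx1 cY1) x1Y1 x1r].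
move=> /and4P[YN xN Y1N rU].
have YY1 : Y <> Y1.
  move=> e; move/negP: YN; apply; rewrite !inE; apply/or3P/Or32/eqP.
  by congr inr; apply: val_inj.
have xx1 : x <> x1.
  move=> e; move/negP: xN; apply; rewrite !inE; apply/or3P/Or32/eqP.
  by congr inl; apply: val_inj.
have [u1 xu1 xu1d] := dist_step hT.1 xx1.
have [w x1w x1wd] := dist_step hT.1 (nesym xx1).
have uu1 : u <> u1.
  move=> e; apply: YY1; apply: (cylinder_eq cY cY1 Yxu).
  by rewrite e; apply: (cylinder_toward cY1 xY1 x1Y1 xu1).
(* The directions from [x] to [x0] and to [x1] differ, because their edges lie in distinct
   cylinders; so [x] is between [x0] and [x1]. *)
have x10 := dist_concat xu1 xu (nesym uu1) xu1d xx0.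
apply: (IH _ x1 vx1 Y1 cY1 w) => //; first exact: ltnW.
- have [e|//] := adj_dist hT.1 x0 x1w.
  have := dist_triangle hT.1 x w x0; rewrite e [dist x1 x0]distC x10.
  by rewrite (distC _ x0 x) (distC _ x x1) x1wd; lia.
- exact: (cylinder_toward cY1 x1Y1 xY1 x1w).
- exact/andP.
Qed.

Lemma Tc_acyclic_V0 x0 (v0 : cyl_V0 x0) (c : seq Tc) :
  ucycle (@Defs.adj G Tc) (V0_vertex v0 :: c) -> (size c <= 1)%N.
Proof.
case: c => [//|s [//|t c]] /andP[]; rewrite (cycle_path (V0_vertex v0)).
elim/Tc_ind: s => [x vx|Y cY]; first by rewrite /= andbF.
elim/Tc_ind: t => [x vx|Z cZ]; last by rewrite /= !andbF.
move=> /= /and4P[lx /(adj_V0_cyl v0 cY) x0Y /(adj_V0_cyl vx cY) xY xc].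
rewrite -/(uniq [:: cyl_vertex cY, V0_vertex vx & c]) !inE !negb_or.
move=> /andP[/and3P[_ /eqP x0x _] cU].
have {}x0x : x <> x0 by move=> e; apply: x0x; congr inl; apply: val_inj.
have [u xu xx0] := dist_step hT.1 x0x.
have := Tc_no_return v0 (leqnn _) xu xx0 (cylinder_toward cY xY x0Y xu xx0) xc cU.
by move=> /negP[].
Qed.

Lemma Tc_is_tree : is_tree Tc.
Proof.
split.
- exact: Tc_nonempty.
- by move=> [].
- exact: Tc_adj_sym.
- exact: Tc_connected.
- case=> [//|s c]; elim/Tc_ind: s => [x vx /Tc_acyclic_V0//|Y cY].
  case: c => [//|t c]; elim/Tc_ind: t => [x vx|Z cZ]; last first.
    by rewrite /ucycle (cycle_path (cyl_vertex cY)) /= andbF.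
  (* Rotating once makes the cycle start at a vertex of [T]. *)
  rewrite -(rot_ucycle 1) /= rot1_cons => /Tc_acyclic_V0.
  by rewrite size_rcons.
- by move=> g s t st [gs gt]; case: s t st gs gt => ? [].
Qed.

(** * Edge stabilizers, acylindricity, elliptic subgroups and domination *)

Lemma Tc_edge_stab (s t : Tc) : Defs.adj s t -> nontrivial_abelian G (estab s t).
Proof.
have main x (vx : cyl_V0 x) Y (cY : is_cylinder Y) : in_cylinder x Y ->
    nontrivial_abelian G (vstab (V0_vertex vx) `&` vstab (cyl_vertex cY)).
  move=> /(in_cylinderP cY)[y [a [Yxy xya a1]]].
  rewrite (vstab_cyl_centralizer cY Yxy xya a1); split.
  - have [v1 vM] := subgroup_vstab (V0_vertex vx).
    have [c1 cM] := subgroup_centralizer a.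
    by split=> // g h [gv gc] [hv hc]; split; [exact: vM|exact: cM].
  - by move=> g h [_ ag] [_ ah]; apply: (hcsa.1 _ a1).
  (* The element [a] fixes an edge of [Y] at [x], so it fixes both [x] and [Y]. *)
  - move=> e; apply: a1; suff : [set 1] a by [].
    by rewrite -e vstab_V0; split; [exact: xya.1|exact: commute_refl].
elim/Tc_ind: s => [x vx|Y cY]; elim/Tc_ind: t => [x' vx'|Z cZ] //.
  by move=> /(adj_V0_cyl vx cZ)/main; apply.
by move=> /(adj_V0_cyl vx' cY)/main; rewrite /estab setIC; apply.
Qed.

(** Four consecutive vertices include two distinct cylinders; a non-trivial [g] fixing both would
    make their reference elements commute. *)
Lemma Tc_acylindrical : k_acylindrical Tc 2.
Proof.
have cyl_eq Y (cY : is_cylinder Y) Z (cZ : is_cylinder Z) g : g <> 1 ->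
    act g (cyl_vertex cY) = cyl_vertex cY -> act g (cyl_vertex cZ) = cyl_vertex cZ ->
    cyl_vertex cY = cyl_vertex cZ.
  move=> g1 /vstab_cyl gY /vstab_cyl gZ; congr inr; apply: val_inj => /=.
  have [x [y [a [xy Yxy xya a1]]]] := cylinder_elt cY.
  have [z [w [b [zw Zzw zwb b1]]]] := cylinder_elt cZ.
  move/(cylinder_stabE _ cY Yxy xya a1): gY => ag.
  move/(cylinder_stabE _ cZ Zzw zwb b1): gZ => bg.
  apply: (cylinder_eq cY cZ Yxy).
  apply/(mem_cylinderE cZ Zzw zwb b1 xy xya a1).
  by apply: (commute_trans hcsa g1); apply: commute_sym.
move=> s [//|t [//|r [//|q p]]] /= /and4P[st tr rq _] + _ g gfix.
rewrite !inE => /and3P[/norP[_ /norP[sr _]] /norP[_ /norP[tq _]] _].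
apply: contrapT => g1.
have gs : act g s = s by apply: gfix; rewrite mem_head.
have gt : act g t = t by apply: gfix; rewrite !inE eqxx orbT.
have gr : act g r = r by apply: gfix; rewrite !inE eqxx !orbT.
have gq : act g q = q by apply: gfix; rewrite !inE eqxx !orbT.
elim/Tc_ind: s st sr gs {gfix} => [x vx|Y cY].
  elim/Tc_ind: t tr tq gt => [//|Y cY]; elim/Tc_ind: r gr rq => [y vy|//].
  elim/Tc_ind: q gq => [//|Z cZ] gZ _ _ _ /eqP YZ gY *.
  exact/YZ/(cyl_eq _ _ _ _ g).
elim/Tc_ind: t tr tq gt => [y vy|//]; elim/Tc_ind: r gr rq => [//|Z cZ].
by move=> gZ _ _ _ _ _ /eqP YZ gY; apply/YZ/(cyl_eq _ _ _ _ g).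
Qed.

Lemma elliptic_Tc_of_elliptic (H : set G) : elliptic T H -> elliptic Tc H.
Proof.
move=> [x Hx]; have [x0|/notV0_vstab[Y [cY xY]]] := pselect (cyl_V0 x).
  by exists (V0_vertex x0); rewrite vstab_V0.
by exists (cyl_vertex cY); apply: subset_trans xY.
Qed.

Lemma elliptic_Tc_of_noncyclic (A : set G) : subgroup A -> abelian A -> ~ cyclic A ->
  elliptic Tc A.
Proof.
move=> hA Aab Anc.
have [x [a [Aa ax a1]]] : exists x a, [/\ A a, act a x = x & a <> 1].
  apply: contrapT => nx; apply: Anc; apply: (free_abelian_cyclic hT.1) => // a x Aa ax.
  by apply: contrapT => a1; apply: nx; exists x, a.
have [[u [v [uv uva]]]|nuv] := pselect (exists u v, adj u v /\ estab u v a).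
  have cY := is_cylinder_of uv; exists (cyl_vertex cY).
  rewrite (vstab_cyl_centralizer cY (in_cylinder_of uv) uva a1) => c Ac.
  exact: Aab.
(* If [a] fixes no edge, convexity makes [x] its only fixed point, so [A] fixes [x]. *)
apply: elliptic_Tc_of_elliptic; exists x => c Ac; apply: contrapT => cx.
have [u xu xcx] := dist_step hT.1 (nesym cx).
apply: nuv; exists x, u; split=> //; split=> //.
have acx : act a (act c x) = act c x by apply: act_commute => //; apply: Aab.
by apply: (@between_fixed _ _ hT.1 _ _ _ _ ax acx); rewrite xcx (dist_adj hT.1 xu).
Qed.

(** A cylinder stabilizer is a centralizer of some [a] elliptic in [T]: if cyclic, it is elliptic in
    [T] by [cyclic_fixed]; otherwise it serves as [A]. *)
Lemma elliptic_of_elliptic_Tc (H : set G) : elliptic Tc H ->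
  elliptic T H \/ exists A, [/\ subgroup A, abelian A, ~ cyclic A & H `<=` A].
Proof.
move=> [t]; elim/Tc_ind: t => [x x0|Y cY].
  by rewrite vstab_V0 => Hx; left; exists x.
have [x [y [a [xy Yxy xya a1]]]] := cylinder_elt cY.
rewrite (vstab_cyl_centralizer cY Yxy xya a1) => Ha.
have [[b bE]|nc] := pselect (cyclic (centralizer a)); last first.
  right; exists (centralizer a); split=> //; last exact: (hcsa.1 _ a1).
  exact: subgroup_centralizer.
left; rewrite bE in Ha.
have ba : generated [set b] a by rewrite -bE; apply: commute_refl.
have [z zb] := cyclic_fixed hT.1 ba a1 xya.1.
by exists z; apply: subset_trans zb.
Qed.

(** Cylinder stabilizers are abelian, and so are stabilizers of vertices outside [cyl_V0]; the
    remaining vertices are common to both trees. *)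
Lemma nonabelian_vstab (H : set G) : ~ abelian H ->
  (exists x : T, H = vstab x) <-> (exists t : Tc, H = vstab t).
Proof.
have vstab_cyl_abelian Y (cY : is_cylinder Y) : abelian (vstab (cyl_vertex cY)).
  have [x [y [a [xy Yxy xya a1]]]] := cylinder_elt cY.
  by rewrite (vstab_cyl_centralizer cY Yxy xya a1); apply: (hcsa.1 _ a1).
move=> Hab; split=> [[x Hx]|[t]].
  have [x0|/notV0_vstab[Y [cY xY]]] := pselect (cyl_V0 x).
    by exists (V0_vertex x0); rewrite vstab_V0.
  case: Hab => g h; rewrite Hx => /xY gY /xY hY; exact: (vstab_cyl_abelian _ cY).
elim/Tc_ind: t => [x x0|Y cY] Ht; first by exists x; rewrite Ht vstab_V0.
by case: Hab; rewrite Ht; apply: vstab_cyl_abelian.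
Qed.

(** For a cylinder with stabilizer [centralizer a], the point [f x] is fixed by [a], and
    acylindricity of [T'] gives a point fixed by the whole centralizer. *)
Lemma Tc_dominates (T' : ggraph G) : is_tree T' -> acylindrical T' ->
  dominates T T' -> dominates Tc T'.
Proof.
move=> hT' aT' [f fE]; apply: equivariant_map_exists => t.
elim/Tc_ind: t => [x x0|Y cY].
  by exists (f x) => g; rewrite vstab_V0 /vstab /= -fE => ->.
have [x [y [a [xy Yxy xya a1]]]] := cylinder_elt cY.
rewrite (vstab_cyl_centralizer cY Yxy xya a1).
apply: (acylindrical_fixed hT' aT' _ a1) => //.
by exists (f x); rewrite -fE xya.1.
Qed.

End CylinderTree.

(** * Trivial collapse and conclusion *)

Lemma collapse_isomorphism (G : groupType) (T : ggraph G) :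
  (forall x y : T, adj x y -> nontrivial_abelian G (estab x y)) ->
  isomorphism (collapse_map (T := T)).
Proof.
move=> hE.
have class1 (x : T) : collapse_class x = [set x].
  apply/seteqP; split=> [_ [[_ <- //|y p /andP[/andP[xy /asboolP[]]]]]|_ ->].
    exact: hE.
  by exists [::].
split.
- have /choice[f fK] (C : collapse T) : exists x, collapse_map x = C.
    case: C => C cC; have [x Cx] := set_mem cC.
    by exists x; apply: val_inj => /=; rewrite Cx.
  exists f => // x; have /(congr1 val) := fK (collapse_map x).
  rewrite /= !class1 => e.
  by have : [set f (collapse_map x)] (f (collapse_map x)) by []; rewrite e.
- by move=> g x; apply: val_inj; rewrite /= act_collapse_class.
- move=> x y; rewrite /= /collapse_adj /= !class1.
  apply/asboolP/idP => [[_ [_ [-> -> /andP[]//]]]|xy].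
  by exists x, y; split=> //; apply/andP; split=> //; apply/asboolP/hE.
Qed.

Theorem proposition6p3 (G : groupType) (hfg : finitely_generated G)
    (htf : torsion_free G) (hcsa : CSA G) (T : ggraph G) (hT : E_tree T) :
  let Tc := tree_of_cylinders T in
  is_tree Tc /\
  ((forall x y : Tc, adj x y -> nontrivial_abelian G (estab x y)) /\
   isomorphism (collapse_map (T := Tc)
                  : Tc -> collapsed_tree_of_cylinders T)) /\
  ((forall H : set G, ~ abelian H ->
      ((exists x : T, H = vstab x) <-> (exists x : Tc, H = vstab x))) /\
   (forall H : set G, subgroup H ->
      (elliptic Tc H <->
         elliptic T H \/
         exists A : set G,
           [/\ subgroup A, abelian A, ~ cyclic A & H `<=` A])) /\
   (same_deformation_space Tc T <->
      forall A : set G, subgroup A -> abelian A -> ~ cyclic A ->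
        elliptic T A)) /\
  (k_acylindrical Tc 2 /\
   forall T' : ggraph G, E_tree T' -> acylindrical T' ->
     dominates T T' -> dominates Tc T').
Proof.
move=> Tc; have TcE := Tc_edge_stab hcsa hT.
split; first exact: Tc_is_tree.
split; first by split=> //; apply: collapse_isomorphism.
split; last first.
  split; first exact: Tc_acylindrical.
  by move=> T' [hT' _]; apply: Tc_dominates.
split; first by move=> H; apply: nonabelian_vstab.
split=> [H _|].
  split; first exact: elliptic_of_elliptic_Tc.
  move=> [|[A [hA Aab Anc HA]]]; first exact: elliptic_Tc_of_elliptic.
  have [t At] := elliptic_Tc_of_noncyclic hcsa hT hA Aab Anc.
  by exists t; apply: subset_trans At.
split=> [TcT A hA Aab Anc|TA H hH].
  by apply/TcT => //; apply: elliptic_Tc_of_noncyclic.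
split; last exact: elliptic_Tc_of_elliptic.
move=> /(elliptic_of_elliptic_Tc hcsa hT)[//|[A [hA Aab Anc HA]]].
by have [x Ax] := TA A hA Aab Anc; exists x; apply: subset_trans Ax.
Qed.
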